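(* For every positive integer $n$, \[ \frac{\pi}{4}J(2n-1)=(-1)^{n-1}\sum_{k=0}^{n-1}(-1)^k\,\beta(2n-2k)\,\frac{1}{(2k)!}\left(\frac{\pi}{2}\right)^{2k}, \] and \[ \frac{\pi}{4}J(2n)=(-1)^{n}\left[\lambda(2n+1)-\sum_{k=0}^{n-1}(-1)^k\,\beta(2n-2k)\,\frac{1}{(2k+1)!}\left(\frac{\pi}{2}\right)^{2k+1}\right]. \]
   Context: The Dirichlet lambda function is $\lambda(s)=\sum_{n=1}^\infty (2n-1)^{-s}$ for $\Re(s)>1$, and the Dirichlet beta function is $\beta(s)=\sum_{n=1}^\infty (-1)^{n-1}(2n-1)^{-s}$ for $\Re(s)>0$. For $\Re(s)>0$, $J(s)=\frac{1}{\Gamma(s+1)}\cdot\frac{2}{\pi}\int_0^{\pi/2}\frac{x^s}{\sin x}\,dx$. *)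

(* Defs.v *)
From Stdlib Require Import Reals.
From Coquelicot Require Import Coquelicot.

Open Scope R_scope.

Definition Cexp (z : C) : C :=
  (exp (Re z) * cos (Im z), exp (Re z) * sin (Im z)).

(* Principal value of x^s; only meaningful for a real base x > 0, since
   [ln x = 0] for x <= 0. *)
Definition Cpower (x : R) (s : C) : C := Cexp (s * ln x)%C.

(* Sum of a complex series, as the limit of its partial sums in order (so
   conditional convergence is allowed); unspecified if it diverges. *)
Definition CSeries (a : nat -> C) : C :=
  iota (T := C_R_CompleteNormedModule)
    (is_series (V := C_R_CompleteNormedModule) a).

(* Euler's integral of the second kind, for Re s > 0. *)
Definition Gamma (s : C) : C :=
  RInt_gen (V := C_R_CompleteNormedModule)
    (fun t => Cpower t (s - 1) * exp (- t))%C
    (at_right 0) (Rbar_locally p_infty).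

(* The summation index is shifted: the term of index n is the (n+1)-st one. *)
Definition Dirichlet_lambda (s : C) : C :=
  CSeries (fun n => Cpower (2 * INR (S n) - 1) (- s)).

Definition Dirichlet_beta (s : C) : C :=
  CSeries (fun n => (-1) ^ n * Cpower (2 * INR (S n) - 1) (- s))%C.

(* The integral is improper at 0, where the integrand is unbounded when
   0 < Re s < 1. *)
Definition J (s : C) : C :=
  (/ Gamma (s + 1) * (2 / PI) *
   RInt_gen (V := C_R_CompleteNormedModule)
     (fun x => Cpower x s / sin x)
     (at_right 0) (at_point (PI / 2)%R))%C.

(* Main.v *)
Require Import Defs.
From Stdlib Require Import Factorial Reals Lra Lia FunctionalExtensionality.
From Coquelicot Require Import Coquelicot.

Open Scope R_scope.

(** From [2 sin x (sin x + sin 3x + ... + sin (2N+1)x) = 1 - cos (2(N+1)x)] one gets,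
    on [[e, PI/2]] with [e > 0],
    [int x^m / sin x = 2 sum_k int x^m sin ((2k+1)x) + int x^m cos (2(N+1)x) / sin x].
    As [x^m / sin x] is nondecreasing for [m >= 1], integration by parts bounds the last
    integral by [O(1/N)] uniformly in [e]; letting [e] tend to [0] and [N] to infinity,
    the improper integral is twice the sum over [k] of the moments
    [int_0^(PI/2) x^m sin ((2k+1)x)].  Two integrations by parts reduce [m] by [2], so
    each moment is a polynomial in [1/(2k+1)], and summing over [k] yields the values of
    beta and lambda. *)

(** * Odd integers and elementary trigonometry *)

Definition odd_real (k : nat) : R := 2 * INR (S k) - 1.

Lemma odd_real_ge_1 (k : nat) : 1 <= odd_real k.
Proof. unfold odd_real. rewrite S_INR. pose proof (pos_INR k). lra. Qed.

Lemma odd_real_neq_0 (k : nat) : odd_real k <> 0.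
Proof. pose proof (odd_real_ge_1 k). lra. Qed.

(** Boundary values for the moments: the vanishing cosine removes the terms that carry it at PI/2,
    and the sine supplies the sign of the beta series. *)
Lemma cos_sin_odd_real_PI2 (k : nat) :
  cos (odd_real k * (PI / 2)) = 0 /\ sin (odd_real k * (PI / 2)) = (-1) ^ k.
Proof.
  induction k as [|k [IHc IHs]].
  - unfold odd_real; simpl. replace ((2 * 1 - 1) * (PI / 2)) with (PI / 2) by field.
    rewrite cos_PI2, sin_PI2. now split.
  - replace (odd_real (S k) * (PI / 2)) with (odd_real k * (PI / 2) + PI)
      by (unfold odd_real; rewrite (S_INR (S k)); field).
    rewrite neg_cos, neg_sin, IHc, IHs. simpl. split; ring.
Qed.

(** The difference vanishes at 0 and has derivative [t * sin t], nonnegative up to PI/2. This yields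
    the monotonicity of [pow_div_sin]. *)
Lemma x_cos_le_sin (x : R) : 0 <= x <= PI / 2 -> x * cos x <= sin x.
Proof.
  intros [H0 H1].
  destruct (MVT_gen (fun t => sin t - t * cos t) 0 x (fun t => t * sin t))
    as [c [[Hc1 Hc2] Hc]].
  - intros t _. auto_derive; [easy|ring].
  - intros t _. apply derivable_continuous_pt, ex_derive_Reals_0. auto_derive; easy.
  - rewrite Rmin_left in Hc1 by easy. rewrite Rmax_right in Hc2 by easy.
    rewrite sin_0 in Hc.
    assert (0 <= sin c) by (apply sin_ge_0; pose proof PI_RGT_0; lra).
    assert (0 <= c * sin c * (x - 0)) by (repeat apply Rmult_le_pos; lra).
    lra.
Qed.

(** * The integrand and its oscillatory integral *)

(** The exponent is [S m] because the integrand is nondecreasing only from exponent 1 on. *)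
Definition pow_div_sin (m : nat) (x : R) : R := x ^ S m / sin x.

Definition pow_div_sin' (m : nat) (x : R) : R :=
  (INR (S m) * x ^ m * sin x - x ^ S m * cos x) / (sin x) ^ 2.

Lemma sin_pos_PI2 (x : R) : 0 < x <= PI / 2 -> 0 < sin x.
Proof. intros H. pose proof PI_RGT_0. apply sin_gt_0; lra. Qed.

Lemma is_derive_pow_div_sin (m : nat) (x : R) :
  0 < x <= PI / 2 -> is_derive (pow_div_sin m) x (pow_div_sin' m x).
Proof.
  intros H. pose proof (sin_pos_PI2 x H). unfold pow_div_sin, pow_div_sin'.
  auto_derive; [lra|]. 
  change (match m with O => 1 | S _ => INR m + 1 end) with (INR (S m)).
  rewrite <- tech_pow_Rmult. field. lra.
Qed.

Lemma continuous_pow_div_sin' (m : nat) (x : R) :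
  0 < x <= PI / 2 -> continuous (pow_div_sin' m) x.
Proof.
  intros H. pose proof (sin_pos_PI2 x H).
  apply (ex_derive_continuous (pow_div_sin' m)). unfold pow_div_sin'.
  auto_derive. apply Rmult_integral_contrapositive_currified; lra.
Qed.

Lemma pow_div_sin_nonneg (m : nat) (x : R) :
  0 < x <= PI / 2 -> 0 <= pow_div_sin m x.
Proof.
  intros H. pose proof (sin_pos_PI2 x H). unfold pow_div_sin.
  apply Rdiv_le_0_compat; [apply pow_le; lra|easy].
Qed.

Lemma pow_div_sin'_nonneg (m : nat) (x : R) :
  0 < x <= PI / 2 -> 0 <= pow_div_sin' m x.
Proof.
  intros H. pose proof (sin_pos_PI2 x H). unfold pow_div_sin'.
  apply Rdiv_le_0_compat; [|now apply pow_lt].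
  rewrite S_INR, <- tech_pow_Rmult.
  replace ((INR m + 1) * x ^ m * sin x - x * x ^ m * cos x)
    with (x ^ m * (INR m * sin x + (sin x - x * cos x))) by ring.
  pose proof (x_cos_le_sin x ltac:(lra)). pose proof (pos_INR m).
  apply Rmult_le_pos; [apply pow_le; lra|].
  assert (0 <= INR m * sin x) by (apply Rmult_le_pos; lra). lra.
Qed.

(* Integration by parts; no integrability at 0 is needed, because the
   derivative of [pow_div_sin m] has constant sign. *)
Lemma oscillatory_bound (m N : nat) (e v : R) :
  0 < e <= PI / 2 ->
  is_RInt (fun x => pow_div_sin m x * cos (2 * INR (S N) * x)) e (PI / 2) v ->
  Rabs v <= pow_div_sin m (PI / 2) / INR (S N).
Proof.
  intros He Hv. set (w := 2 * INR (S N)) in *.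
  assert (Hw : 0 < w) by (unfold w; rewrite S_INR; pose proof (pos_INR N); lra).
  set (f := pow_div_sin m) in *. set (f' := pow_div_sin' m).
  assert (Hin : forall x, Rmin e (PI / 2) <= x <= Rmax e (PI / 2) -> 0 < x <= PI / 2).
  { intros x. rewrite Rmin_left, Rmax_right by lra. lra. }
  assert (ID : is_RInt f' e (PI / 2) (f (PI / 2) - f e)).
  { apply (is_RInt_derive f f').
    - intros x Hx. apply is_derive_pow_div_sin, Hin, Hx.
    - intros x Hx. apply continuous_pow_div_sin', Hin, Hx. }
  assert (IP : is_RInt (fun x => f' x * (sin (w * x) / w) + f x * cos (w * x)) e (PI / 2)
            (f (PI / 2) * (sin (w * (PI / 2)) / w) - f e * (sin (w * e) / w))).
  { apply (is_RInt_derive (fun x => f x * (sin (w * x) / w))).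
    - intros x Hx. apply (is_derive_mult f (fun y => sin (w * y) / w)).
      + apply is_derive_pow_div_sin, Hin, Hx.
      + auto_derive; [easy|field; lra].
      + intros; apply Rmult_comm.
    - intros x Hx. apply Hin in Hx.
      apply (continuous_plus (fun y => f' y * (sin (w * y) / w)) (fun y => f y * cos (w * y)));
        apply (continuous_mult (K := R_AbsRing)).
      + apply continuous_pow_div_sin', Hx.
      + apply (ex_derive_continuous (fun y => sin (w * y) / w)). auto_derive; easy.
      + apply (ex_derive_continuous f). eexists. apply is_derive_pow_div_sin, Hx.
      + apply (ex_derive_continuous (fun y => cos (w * y))). auto_derive; easy. }
  pose proof (is_RInt_minus _ _ _ _ _ _ IP Hv) as IM.
  pose proof (is_RInt_scal _ _ _ (/ w) _ ID) as IS.
  assert (B := fun H => norm_RInt_le _ _ _ _ _ _ (proj2 He) H IM IS).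
  assert (Hsin : forall y, Rabs (sin y / w) <= / w).
  { intros y. unfold Rdiv. rewrite Rabs_mult, Rabs_inv, (Rabs_pos_eq w) by lra.
    rewrite <- (Rmult_1_l (/ w)) at 2. apply Rmult_le_compat_r.
    - left. now apply Rinv_0_lt_compat.
    - apply Rabs_le, SIN_bound. }
  specialize (B ltac:(
    intros x Hx;
    change (Rabs ((f' x * (sin (w * x) / w) + f x * cos (w * x))
                  - f x * cos (w * x)) <= / w * f' x);
    replace (_ - _) with (sin (w * x) / w * f' x) by ring;
    assert (0 <= f' x) by (apply pow_div_sin'_nonneg; lra);
    rewrite Rabs_mult, (Rabs_pos_eq (f' x)) by easy;
    now apply Rmult_le_compat_r)).
  change (Rabs (f (PI / 2) * (sin (w * (PI / 2)) / w) - f e * (sin (w * e) / w) - v)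
          <= / w * (f (PI / 2) - f e)) in B.
  assert (P1 : 0 <= f (PI / 2)) by (apply pow_div_sin_nonneg; lra).
  assert (P2 : 0 <= f e) by (apply pow_div_sin_nonneg; lra).
  assert (Q1 : Rabs (f (PI / 2) * (sin (w * (PI / 2)) / w)) <= f (PI / 2) * / w).
  { rewrite Rabs_mult, (Rabs_pos_eq (f _)) by easy. now apply Rmult_le_compat_l. }
  assert (Q2 : Rabs (f e * (sin (w * e) / w)) <= f e * / w).
  { rewrite Rabs_mult, (Rabs_pos_eq (f _)) by easy. now apply Rmult_le_compat_l. }
  (* The two boundary terms and the integral contribute at most [f (PI / 2) / w], [f e / w] and
     [(f (PI / 2) - f e) / w]. In the sum [f e] cancels, so the bound is uniform in [e]. *)
  replace (f (PI / 2) / INR (S N)) with (2 * (/ w * f (PI / 2)))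
    by (unfold w; field; apply not_0_INR; lia).
  apply Rabs_le_between in B, Q1, Q2. apply Rabs_le. lra.
Qed.

(** * Dirichlet kernel and sine moments *)

(** The sum telescopes, since 2 sin x sin((2k+1)x) = cos(2kx) - cos(2(k+1)x). *)
Lemma dirichlet_kernel (N : nat) (x : R) :
  2 * sin x * sum_n (fun k => sin (odd_real k * x)) N = 1 - cos (2 * INR (S N) * x).
Proof.
  induction N as [|N IH].
  - rewrite sum_O. unfold odd_real. simpl INR.
    replace ((2 * 1 - 1) * x) with x by ring. replace (2 * 1 * x) with (2 * x) by ring.
    rewrite cos_2a_sin. ring.
  - rewrite sum_Sn. change plus with Rplus.
    rewrite Rmult_plus_distr_l, IH.
    replace (2 * INR (S N) * x) with (odd_real (S N) * x - x)
      by (unfold odd_real; rewrite (S_INR (S N)); ring).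
    replace (2 * INR (S (S N)) * x) with (odd_real (S N) * x + x)
      by (unfold odd_real; ring).
    rewrite cos_minus, cos_plus. ring.
Qed.

(** Primitives of x^m sin(ax) and x^m cos(ax), built as a pair because each integration by parts
    exchanges sine and cosine. *)
Fixpoint trig_prim (a : R) (m : nat) (x : R) : R * R :=
  match m with
  | O => (- cos (a * x) / a, sin (a * x) / a)
  | S p => (- x ^ m * cos (a * x) / a + INR m / a * snd (trig_prim a p x),
            x ^ m * sin (a * x) / a - INR m / a * fst (trig_prim a p x))
  end.

Lemma is_derive_trig_prim (a : R) (m : nat) (x : R) : a <> 0 ->
  is_derive (fun t => fst (trig_prim a m t)) x (x ^ m * sin (a * x)) /\
  is_derive (fun t => snd (trig_prim a m t)) x (x ^ m * cos (a * x)).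
Proof.
  intros Ha. induction m as [|m [IH1 IH2]].
  - simpl. split; auto_derive; try easy; field; easy.
  - cbn [trig_prim fst snd]. split.
    + replace (x ^ S m * sin (a * x)) with
        (plus (x ^ S m * sin (a * x) - INR (S m) * x ^ m * cos (a * x) / a)
          (INR (S m) / a * (x ^ m * cos (a * x)))) by (unfold plus; simpl; field; easy).
      apply (is_derive_plus (fun t => - t ^ S m * cos (a * t) / a)).
      * auto_derive; [easy|].
        change (match m with O => 1 | S _ => INR m + 1 end) with (INR (S m)).
        rewrite <- tech_pow_Rmult. field. easy.
      * now apply (is_derive_scal (fun t => snd (trig_prim a m t))).
    + replace (x ^ S m * cos (a * x)) with
        (minus (x ^ S m * cos (a * x) + INR (S m) * x ^ m * sin (a * x) / a)
          (INR (S m) / a * (x ^ m * sin (a * x))))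
        by (unfold minus, plus, opp; simpl; field; easy).
      apply (is_derive_minus (fun t => t ^ S m * sin (a * t) / a)).
      * auto_derive; [easy|].
        change (match m with O => 1 | S _ => INR m + 1 end) with (INR (S m)).
        rewrite <- tech_pow_Rmult. field. easy.
      * now apply (is_derive_scal (fun t => fst (trig_prim a m t))).
Qed.

(** The integral of x^m sin((2k+1)x) from [e] to PI/2. Its definition through a primitive makes
    continuity in [e] and the value at [e = 0] directly accessible. *)
Definition sin_moment (m k : nat) (e : R) : R :=
  fst (trig_prim (odd_real k) m (PI / 2)) - fst (trig_prim (odd_real k) m e).

Lemma is_RInt_sin_moment (m k : nat) (e : R) :
  is_RInt (fun x => x ^ m * sin (odd_real k * x)) e (PI / 2) (sin_moment m k e).
Proof.
  apply (is_RInt_derive (fun x => fst (trig_prim (odd_real k) m x))).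
  - intros x _. apply is_derive_trig_prim, odd_real_neq_0.
  - intros x _. apply (ex_derive_continuous (fun x => x ^ m * sin (odd_real k * x))).
    auto_derive; easy.
Qed.

Lemma is_RInt_sum_sin_moment (m N : nat) (e : R) :
  is_RInt (fun x => sum_n (fun k => x ^ m * sin (odd_real k * x)) N) e (PI / 2)
    (sum_n (fun k => sin_moment m k e) N).
Proof.
  induction N as [|N IH].
  - rewrite sum_O. apply is_RInt_ext with (2 := is_RInt_sin_moment m 0 e).
    intros x _. now rewrite sum_O.
  - rewrite sum_Sn.
    apply is_RInt_ext with (2 := is_RInt_plus _ _ _ _ _ _ IH (is_RInt_sin_moment m (S N) e)).
    intros x _. now rewrite sum_Sn.
Qed.

Lemma continuous_sin_moment (m k : nat) (e : R) :
  continuous (fun e => sin_moment m k e) e.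
Proof.
  apply (continuous_minus (fun _ => fst (trig_prim (odd_real k) m (PI / 2)))).
  - apply continuous_const.
  - apply (ex_derive_continuous (fun x => fst (trig_prim (odd_real k) m x))).
    exists (e ^ m * sin (odd_real k * e)).
    exact (proj1 (is_derive_trig_prim _ m e (odd_real_neq_0 k))).
Qed.

Lemma continuous_sum_sin_moment (m N : nat) (e : R) :
  continuous (fun e => sum_n (fun k => sin_moment m k e) N) e.
Proof.
  induction N as [|N IH].
  - apply (continuous_ext (fun e => sin_moment m 0 e)).
    + intros x. now rewrite sum_O.
    + apply continuous_sin_moment.
  - apply (continuous_ext (fun e => plus (sum_n (fun k => sin_moment m k e) N)
                                        (sin_moment m (S N) e))).
    + intros x. now rewrite sum_Sn.
    + apply (continuous_plus (fun e => sum_n (fun k => sin_moment m k e) N)); [exact IH|].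
      apply continuous_sin_moment.
Qed.

(** * The improper integral as a series of moments *)

Lemma sum_n_mult_l (c : R) (u : nat -> R) (N : nat) :
  sum_n (fun k => c * u k) N = c * sum_n u N.
Proof. exact (sum_n_scal_l (K := R_Ring) (V := Ring_ModuleSpace R_Ring) c u N). Qed.

(** By the Dirichlet kernel the difference is exactly the oscillatory integral. The bound is free of
    [e], so [N] can be fixed before [e] tends to 0. *)
Lemma truncation_error (m N : nat) (e : R) : 0 < e <= PI / 2 ->
  exists v, is_RInt (pow_div_sin m) e (PI / 2) v /\
    Rabs (v - 2 * sum_n (fun k => sin_moment (S m) k e) N)
      <= pow_div_sin m (PI / 2) / INR (S N).
Proof.
  intros He.
  assert (Hin : forall x, Rmin e (PI / 2) <= x <= Rmax e (PI / 2) -> 0 < x <= PI / 2).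
  { intros x. rewrite Rmin_left, Rmax_right by lra. lra. }
  destruct (ex_RInt_continuous (V := R_CompleteNormedModule) (pow_div_sin m) e (PI / 2))
    as [v Hv].
  { intros x Hx. apply (ex_derive_continuous (pow_div_sin m)).
    eexists. apply is_derive_pow_div_sin, Hin, Hx. }
  exists v. split; [exact Hv|].
  apply (oscillatory_bound m N e); [exact He|].
  apply is_RInt_ext with
    (2 := is_RInt_minus _ _ _ _ _ _ Hv
            (is_RInt_scal _ _ _ 2 _ (is_RInt_sum_sin_moment (S m) N e))).
  intros x Hx.
  assert (Hx' : 0 < x <= PI / 2) by (apply Hin; lra).
  pose proof (sin_pos_PI2 x Hx').
  change (pow_div_sin m x - 2 * sum_n (fun k => x ^ S m * sin (odd_real k * x)) N
          = pow_div_sin m x * cos (2 * INR (S N) * x)).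
  rewrite sum_n_mult_l.
  replace (cos (2 * INR (S N) * x))
    with (1 - 2 * sin x * sum_n (fun k => sin (odd_real k * x)) N)
    by (rewrite dirichlet_kernel; ring).
  unfold pow_div_sin. field. lra.
Qed.

Lemma is_RInt_gen_pow_div_sin (m : nat) (l : R) :
  is_series (fun k => sin_moment (S m) k 0) l ->
  is_RInt_gen (pow_div_sin m) (at_right 0) (at_point (PI / 2)) (2 * l).
Proof.
  intros Hl. unfold is_RInt_gen.
  intros P [d Hd].
  set (M := pow_div_sin m (PI / 2)).
  (* The budget is one fifth for the truncation error, and two fifths each for the shift from [e] to
     0 and the tail of the series, both of which are doubled. *)
  assert (Hd5 : 0 < d / 5) by (destruct d; simpl; lra).
  destruct (proj1 (filterlim_locally _ _) Hl (mkposreal _ Hd5)) as [N1 HN1].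
  destruct (nfloor_ex (Rabs M / (d / 5))) as [N2 HN2].
  { apply Rdiv_le_0_compat; [apply Rabs_pos|easy]. }
  set (N := max N1 N2).
  specialize (HN1 N (Nat.le_max_l _ _)).
  assert (HM : M / INR (S N) < d / 5).
  { assert (Rabs M / (d / 5) < INR (S N)).
    { apply Rlt_le_trans with (1 := proj2 HN2). rewrite S_INR.
      apply Rplus_le_compat_r, le_INR, Nat.le_max_r. }
    apply Rle_lt_trans with (Rabs M / INR (S N)).
    - apply Rmult_le_compat_r; [|apply Rle_abs].
      left. apply Rinv_0_lt_compat, lt_0_INR. lia.
    - apply Rlt_div_l; [apply lt_0_INR; lia|].
      apply Rlt_div_l in H; lra. }
  pose proof (continuous_sum_sin_moment (S m) N 0) as Hc.
  destruct (proj1 (filterlim_locally _ _) Hc (mkposreal _ Hd5)) as [h Hh].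
  assert (HPI : 0 < PI / 2) by (pose proof PI_RGT_0; lra).
  apply Filter_prod with (fun e => 0 < e <= PI / 2 /\ Rabs e < h) (fun b => b = PI / 2).
  - exists (mkposreal _ (Rmin_pos h (PI / 2) (cond_pos h) HPI)). intros y Hy Hy0.
    change (Rabs (y - 0) < Rmin h (PI / 2)) in Hy.
    rewrite Rminus_0_r in Hy.
    pose proof (Rmin_l h (PI / 2)). pose proof (Rmin_r h (PI / 2)).
    split; [|lra]. rewrite Rabs_pos_eq in Hy by lra. lra.
  - reflexivity.
  - intros e b [He Heh] ->. simpl.
    destruct (truncation_error m N e He) as [v [Hv Hvb]].
    exists v. split; [exact Hv|]. apply Hd.
    assert (Hh' := Hh e ltac:(change (Rabs (e - 0) < h); now rewrite Rminus_0_r)).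
    change (Rabs (sum_n (fun k => sin_moment (S m) k e) N
                  - sum_n (fun k => sin_moment (S m) k 0) N) < d / 5) in Hh'.
    change (Rabs (sum_n (fun k => sin_moment (S m) k 0) N - l) < d / 5) in HN1.
    change (Rabs (v - 2 * l) < d). fold M in Hvb.
    apply Rabs_lt_between in Hh', HN1. apply Rabs_le_between in Hvb.
    apply Rabs_lt_between. lra.
Qed.

(* Lets [ring] and [field] see an equation stated in a carrier of Coquelicot's
   hierarchy that is only convertible to [R]. *)
Ltac eq_in_R := match goal with |- ?l = ?r => change (@eq R l r) end.

(** * Closed forms of the moments *)

(** Base case of even exponents; its contribution becomes the lambda term. *)
Lemma sin_moment_0 (k : nat) : sin_moment 0 k 0 = / odd_real k.
Proof.
  unfold sin_moment; simpl. rewrite (proj1 (cos_sin_odd_real_PI2 k)), Rmult_0_r, cos_0.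
  field. apply odd_real_neq_0.
Qed.

Lemma sin_moment_1 (k : nat) : sin_moment 1 k 0 = (-1) ^ k / odd_real k ^ 2.
Proof.
  unfold sin_moment; simpl. destruct (cos_sin_odd_real_PI2 k) as [-> ->].
  rewrite !Rmult_0_r, sin_0. field. apply odd_real_neq_0.
Qed.

(** Two integrations by parts. The boundary terms vanish at 0 because of the positive powers, and at
    PI/2 only the one with a sine remains. Division by the factorial absorbs the factor
    (m+2)(m+1). *)
Lemma sin_moment_SS (m k : nat) :
  sin_moment (S (S m)) k 0 / INR (fact (S (S m))) =
  (-1) ^ k / odd_real k ^ 2 * (/ INR (fact (S m)) * (PI / 2) ^ S m)
  - sin_moment m k 0 / INR (fact m) / odd_real k ^ 2.
Proof.
  unfold sin_moment. cbn [trig_prim fst snd].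
  destruct (cos_sin_odd_real_PI2 k) as [-> ->].
  rewrite (pow_i (S (S m))), (pow_i (S m)) by lia.
  rewrite (fact_simpl (S m)), (fact_simpl m), !mult_INR.
  field. pose proof (odd_real_neq_0 k). pose proof (INR_fact_neq_0 m).
  repeat split; try easy; now apply not_0_INR.
Qed.

(* The theorem's [n] is [S n] here, whence the argument [2 (S n) - 2 j] of [u]. *)
Definition alt_sum (c u : nat -> R) (n : nat) : R :=
  sum_n (fun j => (-1) ^ j * u (2 * n + 2 - 2 * j)%nat * c j) n.

(** Raising [n] by one raises every exponent 2n+2-2j by two, hence the division by [a ^ 2], and adds
    the summand j = n+1, of exponent 2. This is the shape of the recurrence [sin_moment_SS]. *)
Lemma alt_sum_S (c : nat -> R) (t a : R) (n : nat) : a <> 0 ->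
  alt_sum c (fun q => t / a ^ q) (S n) =
  alt_sum c (fun q => t / a ^ q) n / a ^ 2 + (-1) ^ S n * (t / a ^ 2) * c (S n).
Proof.
  intros Ha. unfold alt_sum. rewrite sum_Sn. change plus with Rplus. f_equal.
  - unfold Rdiv at 2. rewrite Rmult_comm, <- sum_n_mult_l.
    apply sum_n_ext_loc. intros j Hj.
    replace (2 * S n + 2 - 2 * j)%nat with (2 + (2 * n + 2 - 2 * j))%nat by lia.
    rewrite pow_add. eq_in_R. field. split; [now apply pow_nonzero|easy].
  - now replace (2 * S n + 2 - 2 * S n)%nat with 2%nat by lia.
Qed.

Definition even_coef (j : nat) : R := / INR (fact (2 * j)) * (PI / 2) ^ (2 * j).
Definition odd_coef (j : nat) : R := / INR (fact (2 * j + 1)) * (PI / 2) ^ (2 * j + 1).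

Lemma sin_moment_odd (n k : nat) :
  sin_moment (2 * n + 1) k 0 / INR (fact (2 * n + 1)) =
  (-1) ^ n * alt_sum even_coef (fun q => (-1) ^ k / odd_real k ^ q) n.
Proof.
  induction n as [|n IH].
  - unfold alt_sum, even_coef. rewrite sum_O. simpl (2 * 0 + 1)%nat. rewrite sin_moment_1.
    simpl. field. apply odd_real_neq_0.
  - rewrite alt_sum_S by apply odd_real_neq_0.
    replace (2 * S n + 1)%nat with (S (S (2 * n + 1))) by lia.
    (* The third occurrence is the coefficient of the new summand; the other two stay inside
       [alt_sum]. *)
    rewrite sin_moment_SS, IH. unfold even_coef at 3.
    replace (2 * S n)%nat with (S (2 * n + 1)) by lia.
    rewrite Rmult_plus_distr_l.
    (* The outer sign and the sign of the new summand agree, so their product is 1. *)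
    replace ((-1) ^ S n * ((-1) ^ S n * ((-1) ^ k / odd_real k ^ 2) *
       (/ INR (fact (S (2 * n + 1))) * (PI / 2) ^ S (2 * n + 1))))
      with (((-1) ^ S n * (-1) ^ S n) * ((-1) ^ k / odd_real k ^ 2 *
       (/ INR (fact (S (2 * n + 1))) * (PI / 2) ^ S (2 * n + 1)))) by ring.
    rewrite <- Rpow_mult_distr. replace (-1 * -1) with 1 by ring. rewrite pow1.
    rewrite <- (tech_pow_Rmult (-1) n). unfold Rdiv. ring.
Qed.

(** Same induction as for odd exponents, but the recurrence ends at [sin_moment 0], which leaves the
    extra pure power outside the alternating sum. *)
Lemma sin_moment_even (n k : nat) :
  sin_moment (2 * n + 2) k 0 / INR (fact (2 * n + 2)) =
  (-1) ^ S n * (/ odd_real k ^ (2 * n + 3)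
    - alt_sum odd_coef (fun q => (-1) ^ k / odd_real k ^ q) n).
Proof.
  pose proof (odd_real_neq_0 k).
  induction n as [|n IH].
  - unfold alt_sum, odd_coef. rewrite sum_O. simpl (2 * 0 + _)%nat.
    rewrite sin_moment_SS, sin_moment_0. simpl. field. easy.
  - rewrite alt_sum_S by easy.
    replace (2 * S n + 2)%nat with (S (S (2 * n + 2))) by lia.
    rewrite sin_moment_SS, IH. unfold odd_coef at 3.
    replace (2 * S n + 1)%nat with (S (2 * n + 2)) by lia.
    replace (2 * S n + 3)%nat with (2 + (2 * n + 3))%nat by lia.
    rewrite (pow_add _ 2), (Rinv_mult (odd_real k ^ 2)).
    set (A := (-1) ^ k / odd_real k ^ 2 *
       (/ INR (fact (S (2 * n + 2))) * (PI / 2) ^ S (2 * n + 2))).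
    rewrite (Rmult_assoc ((-1) ^ S n)). fold A.
    rewrite <- (tech_pow_Rmult (-1) (S n)).
    assert (E : (-1) ^ S n * (-1) ^ S n = 1).
    { rewrite <- Rpow_mult_distr. replace (-1 * -1) with 1 by ring. apply pow1. }
    unfold Rdiv. apply Rminus_diag_uniq.
    (* Everything but the new boundary term [A] cancels, and [A] survives with the factor 1 minus a
       squared sign. *)
    match goal with |- ?L = 0 => replace L with (A * (1 - (-1) ^ S n * (-1) ^ S n)) by ring end.
    rewrite E. ring.
Qed.

(** * Summation over the odd integers *)

(** Comparison with a telescoping series: (2k+1)^2 >= (k+1)(k+2)/2, with equality at k = 0, which
    fixes the factor 2. *)
Lemma ex_series_inv_odd_real_pow (q : nat) : (2 <= q)%nat ->
  ex_series (fun k => / odd_real k ^ q).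
Proof.
  intros Hq.
  apply (ex_series_le (V := R_CompleteNormedModule) _
           (fun k => 2 * (/ INR (S k) - / INR (S (S k))))).
  - intros k. change (Rabs (/ odd_real k ^ q) <= 2 * (/ INR (S k) - / INR (S (S k)))).
    pose proof (odd_real_ge_1 k) as Ho.
    rewrite Rabs_pos_eq by (left; apply Rinv_0_lt_compat, pow_lt; lra).
    apply Rle_trans with (/ odd_real k ^ 2).
    + apply Rinv_le_contravar; [apply pow_lt; lra|]. now apply Rle_pow.
    + pose proof (pos_INR k). rewrite !S_INR.
      replace (2 * _) with (/ ((INR k + 1) * (INR k + 1 + 1) / 2)) by (field; lra).
      apply Rinv_le_contravar; [nra|]. unfold odd_real. rewrite S_INR. nra.
  - exists 2.
    apply (filterlim_ext (fun n => 2 * (1 - / INR (S (S n))))).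
    + intros n. induction n as [|n IH].
      * rewrite sum_O. simpl. field.
      * rewrite sum_Sn, <- IH. change plus with Rplus. ring.
    + change (is_lim_seq (fun n => 2 * (1 - / INR (S (S n)))) 2).
      replace (Finite 2) with (Rbar_mult 2 1) by (simpl; f_equal; ring).
      apply is_lim_seq_scal_l.
      replace (Finite 1) with (Finite (1 - 0)) by (f_equal; ring).
      apply is_lim_seq_minus'; [apply is_lim_seq_const|].
      apply (is_lim_seq_incr_1 (fun n => / INR (S n))), (is_lim_seq_incr_1 (fun n => / INR n)).
      replace (Finite 0) with (Rbar_inv p_infty) by reflexivity.
      apply is_lim_seq_inv; [apply is_lim_seq_INR|easy].
Qed.

Lemma ex_series_alt_inv_odd_real_pow (q : nat) : (2 <= q)%nat ->
  ex_series (fun k => (-1) ^ k / odd_real k ^ q).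
Proof.
  intros Hq. apply (ex_series_le (V := R_CompleteNormedModule) _
    (fun k => / odd_real k ^ q)); [|now apply ex_series_inv_odd_real_pow].
  intros k. change (Rabs ((-1) ^ k / odd_real k ^ q) <= / odd_real k ^ q).
  pose proof (odd_real_ge_1 k).
  unfold Rdiv. rewrite Rabs_mult, pow_1_abs, Rmult_1_l, Rabs_pos_eq; [lra|].
  left; apply Rinv_0_lt_compat, pow_lt; lra.
Qed.

Definition beta_real (q : nat) : R := Series (fun k => (-1) ^ k / odd_real k ^ q).
Definition lambda_real (q : nat) : R := Series (fun k => / odd_real k ^ q).

Lemma is_series_sum_n (u : nat -> nat -> R) (l : nat -> R) (n : nat) :
  (forall j, (j <= n)%nat -> is_series (u j) (l j)) ->
  is_series (fun k => sum_n (fun j => u j k) n) (sum_n l n).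
Proof.
  induction n as [|n IH]; intros H.
  - rewrite sum_O. apply is_series_ext with (2 := H 0%nat (le_n _)).
    intros k. now rewrite sum_O.
  - rewrite sum_Sn.
    apply is_series_ext with
      (2 := is_series_plus _ _ _ _ (IH (fun j Hj => H j (le_S _ _ Hj))) (H (S n) (le_n _))).
    intros k. now rewrite sum_Sn.
Qed.

Lemma is_series_mult_l (c : R) (u : nat -> R) (l : R) :
  is_series u l -> is_series (fun k => c * u k) (c * l).
Proof. exact (is_series_scal (K := R_AbsRing) (V := R_NormedModule) c u l). Qed.

(** A finite sum commutes with the series. For [j <= n] the exponent 2n+2-2j is at least 2, so each
    beta series converges absolutely. *)
Lemma is_series_alt_sum (c : nat -> R) (n : nat) :
  is_series (fun k => alt_sum c (fun q => (-1) ^ k / odd_real k ^ q) n)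
    (alt_sum c beta_real n).
Proof.
  apply (is_series_sum_n
    (fun j k => (-1) ^ j * ((-1) ^ k / odd_real k ^ (2 * n + 2 - 2 * j)) * c j)
    (fun j => (-1) ^ j * beta_real (2 * n + 2 - 2 * j) * c j)).
  intros j Hj.
  rewrite Rmult_assoc, (Rmult_comm _ (c j)), <- Rmult_assoc.
  apply is_series_ext with
    (fun k => (-1) ^ j * c j * ((-1) ^ k / odd_real k ^ (2 * n + 2 - 2 * j))).
  { intros k. eq_in_R. ring. }
  apply is_series_mult_l, Series_correct, ex_series_alt_inv_odd_real_pow. lia.
Qed.

Lemma is_series_sin_moment_odd (n : nat) :
  is_series (fun k => sin_moment (2 * n + 1) k 0)
    (INR (fact (2 * n + 1)) * ((-1) ^ n * alt_sum even_coef beta_real n)).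
Proof.
  apply is_series_ext with (fun k => INR (fact (2 * n + 1)) *
     ((-1) ^ n * alt_sum even_coef (fun q => (-1) ^ k / odd_real k ^ q) n)).
  - intros k. rewrite <- sin_moment_odd. eq_in_R. field. apply INR_fact_neq_0.
  - apply is_series_mult_l, is_series_mult_l, is_series_alt_sum.
Qed.

Lemma is_series_sin_moment_even (n : nat) :
  is_series (fun k => sin_moment (2 * n + 2) k 0)
    (INR (fact (2 * n + 2)) *
     ((-1) ^ S n * (lambda_real (2 * n + 3) - alt_sum odd_coef beta_real n))).
Proof.
  apply is_series_ext with (fun k => INR (fact (2 * n + 2)) *
     ((-1) ^ S n * (/ odd_real k ^ (2 * n + 3)
        - alt_sum odd_coef (fun q => (-1) ^ k / odd_real k ^ q) n))).
  - intros k. rewrite <- sin_moment_even. eq_in_R. field. apply INR_fact_neq_0.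
  - apply is_series_mult_l, is_series_mult_l.
    apply (is_series_minus (fun k => / odd_real k ^ (2 * n + 3))).
    + apply Series_correct, ex_series_inv_odd_real_pow. lia.
    + apply is_series_alt_sum.
Qed.

(** * Transfer from real to complex values *)

Lemma sum_n_RtoC (u : nat -> R) (n : nat) :
  sum_n (fun k => RtoC (u k)) n = RtoC (sum_n u n).
Proof.
  induction n as [|n IH]; [now rewrite !sum_O|].
  rewrite !sum_Sn, IH. symmetry. apply RtoC_plus.
Qed.

Lemma filterlim_RtoC (x : R) :
  filterlim RtoC (locally x) (locally (T := C_R_CompleteNormedModule) (RtoC x)).
Proof.
  intros P [d Hd]. exists d. intros y Hy. apply Hd.
  split; [exact Hy|apply ball_center].
Qed.

(** [CSeries] is defined by [iota], so its value is settled by exhibiting a limit of the partial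
    sums, which are real here. *)
Lemma CSeries_RtoC (u : nat -> R) (l : R) :
  is_series u l -> CSeries (fun k => RtoC (u k)) = RtoC l.
Proof.
  intros H.
  apply (iota_filterlim_locally (V := C_R_CompleteNormedModule) (F := eventually)).
  apply filterlim_ext with (fun n => RtoC (sum_n u n)).
  - intros n. symmetry. apply sum_n_RtoC.
  - apply filterlim_comp with (1 := H). apply filterlim_RtoC.
Qed.

(** Integration is componentwise, with imaginary part the integral of 0. Agreement of [f] and [g] is
    asked only strictly between endpoints close to the limits, which spares the singular point 0. *)
Lemma RInt_gen_RtoC (f : R -> R) (g : R -> C) (Fa Fb : (R -> Prop) -> Prop)
  {FFa : ProperFilter' Fa} {FFb : ProperFilter' Fb} (l : R) :
  filter_prod Fa Fb (fun ab => forall x,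
    Rmin (fst ab) (snd ab) < x < Rmax (fst ab) (snd ab) -> RtoC (f x) = g x) ->
  is_RInt_gen f Fa Fb l ->
  RInt_gen (V := C_R_CompleteNormedModule) g Fa Fb = RtoC l.
Proof.
  intros He H. apply is_RInt_gen_unique.
  apply (is_RInt_gen_ext (V := C_R_NormedModule)) with (1 := He).
  intros P HP. pose proof (H _ (filterlim_RtoC l P HP)) as H'.
  unfold filtermapi in *. revert H'. apply filter_imp. intros [a b] [y [Hy Py]].
  exists (RtoC y). split; [|exact Py].
  apply (is_RInt_fct_extend_pair (U := R_NormedModule) (V := R_NormedModule)); [exact Hy|].
  pose proof (is_RInt_const (V := R_NormedModule) a b 0) as H0.
  change (scal (b - a) 0) with ((b - a) * 0) in H0. rewrite Rmult_0_r in H0. exact H0.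
Qed.

Lemma Cexp_RtoC (x : R) : Cexp (RtoC x) = RtoC (exp x).
Proof.
  unfold Cexp. simpl. rewrite cos_0, sin_0. unfold RtoC. f_equal; ring.
Qed.

Lemma Cpower_INR (x : R) (m : nat) : 0 < x -> Cpower x (RtoC (INR m)) = RtoC (x ^ m).
Proof.
  intros Hx. unfold Cpower. rewrite <- RtoC_mult, Cexp_RtoC. f_equal.
  exact (Rpower_pow m x Hx).
Qed.

Lemma Cpower_opp_INR (x : R) (m : nat) :
  0 < x -> Cpower x (- RtoC (INR m)) = RtoC (/ x ^ m).
Proof.
  intros Hx. unfold Cpower. rewrite <- RtoC_opp, <- RtoC_mult, Cexp_RtoC. f_equal.
  rewrite Ropp_mult_distr_l_reverse, exp_Ropp. f_equal. exact (Rpower_pow m x Hx).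
Qed.

Lemma Dirichlet_lambda_INR (q : nat) : (2 <= q)%nat ->
  Dirichlet_lambda (RtoC (INR q)) = RtoC (lambda_real q).
Proof.
  intros Hq. unfold lambda_real.
  rewrite <- (CSeries_RtoC _ _ (Series_correct _ (ex_series_inv_odd_real_pow q Hq))).
  unfold Dirichlet_lambda. f_equal. apply functional_extensionality. intros k.
  fold (odd_real k).
  apply Cpower_opp_INR. pose proof (odd_real_ge_1 k). lra.
Qed.

Lemma Dirichlet_beta_INR (q : nat) : (2 <= q)%nat ->
  Dirichlet_beta (RtoC (INR q)) = RtoC (beta_real q).
Proof.
  intros Hq. unfold beta_real.
  rewrite <- (CSeries_RtoC _ _ (Series_correct _ (ex_series_alt_inv_odd_real_pow q Hq))).
  unfold Dirichlet_beta. f_equal. apply functional_extensionality. intros k.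
  unfold Rdiv. rewrite RtoC_mult, RtoC_pow. f_equal.
  fold (odd_real k).
  apply Cpower_opp_INR. pose proof (odd_real_ge_1 k). lra.
Qed.

(** * Gamma at positive integers *)

(** Primitive of t^m exp(-t) that vanishes at infinity; the recursion is one integration by
    parts. *)
Fixpoint gamma_prim (m : nat) (t : R) : R :=
  match m with
  | O => - exp (- t)
  | S p => - t ^ m * exp (- t) + INR m * gamma_prim p t
  end.

Lemma is_derive_gamma_prim (m : nat) (t : R) :
  is_derive (gamma_prim m) t (t ^ m * exp (- t)).
Proof.
  induction m as [|m IH].
  - simpl. auto_derive; [easy|ring].
  - cbn [gamma_prim].
    replace (t ^ S m * exp (- t)) with
      (plus (t ^ S m * exp (- t) - INR (S m) * t ^ m * exp (- t))
         (INR (S m) * (t ^ m * exp (- t)))) by (unfold plus; simpl; ring).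
    apply (is_derive_plus (fun t => - t ^ S m * exp (- t))).
    + auto_derive; [easy|].
      change (match m with O => 1 | S _ => INR m + 1 end) with (INR (S m)).
      rewrite <- tech_pow_Rmult. ring.
    + now apply (is_derive_scal (gamma_prim m)).
Qed.

Lemma gamma_prim_0 (m : nat) : gamma_prim m 0 = - INR (fact m).
Proof.
  induction m as [|m IH].
  - simpl. rewrite Ropp_0, exp_0. ring.
  - cbn [gamma_prim]. rewrite IH, fact_simpl, mult_INR, pow_i by lia. ring.
Qed.

(** A single Taylor term gives exp t >= t^(m+1)/(m+1)!, whence the upper bound (m+1)!/t. *)
Lemma is_lim_pow_mult_exp_opp (m : nat) : is_lim (fun t => t ^ m * exp (- t)) p_infty 0.
Proof.
  apply (is_lim_le_le_loc (fun _ => 0) (fun t => INR (fact (S m)) * / t)).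
  - exists 0. intros t Ht.
    pose proof (exp_ge_taylor t (S m) (Rlt_le _ _ Ht)) as E. rewrite tech5 in E.
    pose proof (pow_lt t m Ht). pose proof (INR_fact_lt_0 (S m)). pose proof (exp_pos (- t)).
    assert (0 <= sum_f_R0 (fun k => t ^ k / INR (fact k)) m).
    { apply cond_pos_sum. intros k. apply Rdiv_le_0_compat; [apply pow_le; lra|].
      apply INR_fact_lt_0. }
    split; [apply Rmult_le_pos; lra|].
    apply Rmult_le_reg_r with (t * exp t); [apply Rmult_lt_0_compat; [easy|apply exp_pos]|].
    replace (t ^ m * exp (- t) * (t * exp t)) with (t ^ S m).
    + replace (INR (fact (S m)) * / t * (t * exp t)) with (exp t * INR (fact (S m)))
        by (field; lra).
      apply Rle_div_l; [easy|]. lra.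
    + rewrite exp_Ropp. simpl. field. pose proof (exp_pos t). lra.
  - apply is_lim_const.
  - replace (Finite 0) with (Rbar_mult (INR (fact (S m))) 0) by (simpl; f_equal; ring).
    apply is_lim_scal_l.
    replace (Finite 0) with (Rbar_inv p_infty) by reflexivity.
    apply is_lim_inv; [apply is_lim_id|easy].
Qed.

Lemma is_lim_gamma_prim (m : nat) : is_lim (gamma_prim m) p_infty 0.
Proof.
  induction m as [|m IH].
  - replace (Finite 0) with (Rbar_opp 0) by (simpl; f_equal; ring).
    apply is_lim_opp. apply is_lim_ext with (2 := is_lim_pow_mult_exp_opp 0).
    intros t. simpl. ring.
  - cbn [gamma_prim].
    replace 0 with (- 0 + INR (S m) * 0) by ring.
    apply is_lim_plus'.
    + apply is_lim_ext with (fun t => - (t ^ S m * exp (- t))); [intros t; ring|].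
      apply (is_lim_opp _ _ 0). apply is_lim_pow_mult_exp_opp.
    + apply (is_lim_scal_l _ _ _ 0), IH.
Qed.

Lemma is_RInt_gen_gamma (m : nat) :
  is_RInt_gen (fun t => t ^ m * exp (- t)) (at_right 0) (Rbar_locally p_infty)
    (INR (fact m)).
Proof.
  assert (HD : forall t, Derive (gamma_prim m) t = t ^ m * exp (- t)).
  { intros t. apply is_derive_unique, is_derive_gamma_prim. }
  apply is_RInt_gen_ext with (Derive (gamma_prim m)).
  { apply filter_forall. intros [a b] x _. apply HD. }
  replace (INR (fact m)) with (0 - gamma_prim m 0) by (rewrite gamma_prim_0; ring).
  apply is_RInt_gen_Derive.
  - apply filter_forall. intros [a b] x _. eexists. apply is_derive_gamma_prim.
  - apply filter_forall. intros [a b] x _.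
    apply continuous_ext with (fun t => t ^ m * exp (- t)); [intros t; now rewrite HD|].
    apply (ex_derive_continuous (fun t => t ^ m * exp (- t))). auto_derive; easy.
  (* The primitive is smooth across 0, so its one-sided limit there is its value. *)
  - apply (filterlim_filter_le_1 (F := locally 0)); [apply filter_le_within|].
    apply (ex_derive_continuous (gamma_prim m) 0). eexists. apply is_derive_gamma_prim.
  - apply is_lim_gamma_prim.
Qed.

Lemma Gamma_INR_S (m : nat) : Gamma (RtoC (INR m) + 1) = RtoC (INR (fact m)).
Proof.
  unfold Gamma.
  rewrite (RInt_gen_RtoC (fun t => t ^ m * exp (- t)) _ _ _ (INR (fact m)));
    [reflexivity| |apply is_RInt_gen_gamma].
  (* Positive endpoints keep the variable positive, where [Cpower] is the ordinary power. *)
  apply Filter_prod with (fun a => 0 < a) (fun b => 0 < b).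
  - exists (mkposreal 1 Rlt_0_1). easy.
  - exists 0. easy.
  - intros a b Ha Hb x [Hx _]. simpl in Hx.
    assert (0 < x) by (apply Rlt_trans with (2 := Hx), Rmin_pos; easy).
    replace (RtoC (INR m) + 1 - 1)%C with (RtoC (INR m)) by ring.
    now rewrite Cpower_INR, RtoC_mult.
Qed.

(** * Values of J at positive integers *)

(** The factorial cancels the Gamma factor of [J], and PI/4 cancels 2/PI together with the factor 2
    of [is_RInt_gen_pow_div_sin]. *)
Lemma J_INR_S (m : nat) (l : R) :
  is_series (fun k => sin_moment (S m) k 0) (INR (fact (S m)) * l) ->
  (PI / 4 * J (INR (S m)))%C = RtoC l.
Proof.
  intros H. unfold J. rewrite Gamma_INR_S.
  rewrite (RInt_gen_RtoC (pow_div_sin m) _ _ _ (2 * (INR (fact (S m)) * l))).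
  - pose proof (INR_fact_neq_0 (S m)). pose proof PI_neq0.
    rewrite <- RtoC_inv, <- !RtoC_div, <- !RtoC_mult by (easy || lra).
    f_equal. field. easy.
  - assert (HPI : 0 < PI / 2) by (pose proof PI_RGT_0; lra).
    (* With the lower endpoint in (0, PI/2), the variable is positive for [Cpower] and its sine is
       nonzero. *)
    apply Filter_prod with (fun a => 0 < a < PI / 2) (fun b => b = PI / 2).
    + exists (mkposreal _ HPI). intros y Hy Hy0. split; [exact Hy0|].
      change (Rabs (y - 0) < PI / 2) in Hy.
      rewrite Rminus_0_r, Rabs_pos_eq in Hy; lra.
    + reflexivity.
    + intros a b Ha -> x. cbn [fst snd]. rewrite Rmin_left, Rmax_right by lra. intros Hx.
      pose proof (sin_pos_PI2 x ltac:(lra)).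
      unfold pow_div_sin. rewrite Cpower_INR, RtoC_div by lra. reflexivity.
  - now apply is_RInt_gen_pow_div_sin.
Qed.

(** The summand [t] is left abstract so that the sums of the theorem match whatever the grouping of
    their factors. The natural subtraction is exact because [k <= n]. *)
Lemma alt_sum_beta (c : nat -> R) (n : nat) (t : nat -> C) :
  (forall k, (k <= n)%nat -> t k =
     (RtoC (-1) ^ k * Dirichlet_beta (2 * INR (S n) - 2 * INR k) * RtoC (c k))%C) ->
  sum_n t n = RtoC (alt_sum c beta_real n).
Proof.
  intros Ht. unfold alt_sum. rewrite <- sum_n_RtoC. apply sum_n_ext_loc.
  intros k Hk. rewrite (Ht k Hk).
  replace (2 * INR (S n) - 2 * INR k)%C with (RtoC (INR (2 * n + 2 - 2 * k))).
  - rewrite Dirichlet_beta_INR, !RtoC_mult, RtoC_pow by lia. reflexivity.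
  - rewrite <- !RtoC_mult, <- RtoC_minus. f_equal.
    rewrite minus_INR, plus_INR, !mult_INR, (S_INR n) by lia. simpl. ring.
Qed.

Theorem theorem4 (n : nat) (hn : (1 <= n)%nat) :
  (PI / 4 * J (2 * INR n - 1) =
     (-1) ^ (n - 1) *
     sum_n (fun k : nat =>
       (-1) ^ k * Dirichlet_beta (2 * INR n - 2 * INR k) *
       (/ INR (fact (2 * k))) * (PI / 2) ^ (2 * k)) (n - 1))%C
  /\
  (PI / 4 * J (2 * INR n) =
     (-1) ^ n *
     (Dirichlet_lambda (2 * INR n + 1) -
      sum_n (fun k : nat =>
        (-1) ^ k * Dirichlet_beta (2 * INR n - 2 * INR k) *
        (/ INR (fact (2 * k + 1))) * (PI / 2) ^ (2 * k + 1)) (n - 1)))%C.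
Proof.
  destruct n as [|n]; [lia|]. replace (S n - 1)%nat with n by lia.
  rewrite (alt_sum_beta even_coef), (alt_sum_beta odd_coef).
  2, 3: intros k _; unfold odd_coef, even_coef;
    rewrite RtoC_mult, RtoC_pow, RtoC_inv, RtoC_div by (apply INR_fact_neq_0 || lra);
    symmetry; apply Cmult_assoc.
  (* The complex arguments become [INR] of naturals. The bare [2 * INR (S n)] comes last, as it is a
     subterm of the other two. *)
  replace (2 * INR (S n) - 1)%C with (RtoC (INR (S (2 * n)))).
  2: { rewrite <- RtoC_mult, <- RtoC_minus. f_equal.
       rewrite !S_INR, mult_INR. simpl. ring. }
  replace (2 * INR (S n) + 1)%C with (RtoC (INR (2 * n + 3))).
  2: { rewrite <- RtoC_mult, <- RtoC_plus. f_equal.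
       rewrite plus_INR, mult_INR, (S_INR n). simpl. ring. }
  replace (2 * INR (S n))%C with (RtoC (INR (S (2 * n + 1)))).
  2: { rewrite <- RtoC_mult. f_equal. rewrite !S_INR, plus_INR, mult_INR. simpl. ring. }
  rewrite Dirichlet_lambda_INR by lia.
  rewrite <- RtoC_minus, <- !RtoC_pow, <- !RtoC_mult.
  split; apply J_INR_S.
  - replace (S (2 * n)) with (2 * n + 1)%nat by lia. apply is_series_sin_moment_odd.
  - replace (S (2 * n + 1)) with (2 * n + 2)%nat by lia. apply is_series_sin_moment_even.
Qed.
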